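(* For any integer $n \geq 2$ and any real number $r$ with $0 \le r \leq \frac{\pi}{3}$, \[ \kappa_S(n, r) \leq \frac{2\, B\left( \frac{n-1}{2}, \frac{1}{2} \right)}{B\left( \frac{\sec^2 r}{4}; \frac{n-1}{2}, \frac{1}{2} \right)}. \]
   Context: $\mathbb{S}^n$ is the unit sphere in $\mathbb{R}^{n+1}$ with its geodesic (angular) metric. A sphere of radius $r$ in $\mathbb{S}^n$ is the set of points at geodesic distance $r$ from a centre. The kissing number $\kappa_S(n,r)$ is the maximal number of radius-$r$ spheres in $\mathbb{S}^n$ with pairwise disjoint interiors that simultaneously touch a fixed central radius-$r$ sphere. $B(x; y, z) = \int_0^x t^{y-1}(1-t)^{z-1}\,dt$ is the incomplete beta-function for $x \in [0,1]$, $y,z>0$, and $B(y,z) = B(1;y,z)$. *)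

(* Defs.v *)
From HB Require Import structures.
From mathcomp Require Import all_boot all_order all_algebra finmap.
From mathcomp Require Import all_classical all_reals all_analysis.

Set Implicit Arguments.
Unset Strict Implicit.
Unset Printing Implicit Defensive.

Import Order.TTheory GRing.Theory Num.Theory.

Local Open Scope classical_set_scope.
Local Open Scope ring_scope.

Section SphericalGeometry.
Context {R : realType} {n : nat}.
Implicit Types (x y c : 'rV[R]_n.+1) (r : R).

(* The library norm on 'rV[R]_n.+1 is the sup norm, hence the explicit
   Euclidean inner product. *)
Definition dot x y : R := \sum_(i < n.+1) x ord0 i * y ord0 i.

Definition unit_sphere : set 'rV[R]_n.+1 := [set x | dot x x = 1].

Definition geodist x y : R := acos (dot x y).

Definition gsphere c r : set 'rV[R]_n.+1 :=
  [set x | unit_sphere x /\ geodist c x = r].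

Definition ginterior c r : set 'rV[R]_n.+1 :=
  [set x | unit_sphere x /\ geodist c x < r].

(* Tangency: the spheres meet, but neither enters the other's interior. *)
Definition touching c x r : Prop :=
  gsphere c r `&` gsphere x r !=set0 /\
  ginterior c r `&` ginterior x r = set0.

(* A sphere of radius r < pi / 2 is determined by its centre, so a family of
   distinct spheres of common radius r is given by a set of centres. *)
Definition kissing_configuration r c (X : {fset 'rV[R]_n.+1}) : Prop :=
  [/\ unit_sphere c,
      {in X, forall x, unit_sphere x /\ touching c x r}
    & trivIset [set` X] (fun x => ginterior x r)].

End SphericalGeometry.

(* The supremum is over all central spheres; by homogeneity of the sphere the
   choice of c is immaterial. A value in \bar R avoids presupposing that the
   sizes of configurations are bounded. *)
Definition kissing_number {R : realType} (n : nat) (r : R) : \bar R :=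
  ereal_sup [set N | exists (c : 'rV[R]_n.+1) (X : {fset 'rV[R]_n.+1}),
                       kissing_configuration r c X /\ N = (#|` X|%:R)%:E].

(* powR assigns a junk value at base 0 and negative exponent; this only concerns
   the endpoints, which are null for the Lebesgue measure. *)
Definition incomplete_beta {R : realType} (x y z : R) : R :=
  \int[@lebesgue_measure R]_(t in `[0, x])
     (t `^ (y - 1) * (1 - t) `^ (z - 1)).

Definition beta {R : realType} (y z : R) : R := incomplete_beta 1 y z.

Definition sec {R : realType} (r : R) : R := (cos r)^-1.

(* Main.v *)
Require Import Defs.
From mathcomp Require Import all_boot all_order all_algebra.
From mathcomp Require Import all_classical all_reals all_analysis.
From mathcomp Require Import measurable_realfun finmap.
From mathcomp Require Import ring lra zify.

Set Implicit Arguments.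
Unset Strict Implicit.
Unset Printing Implicit Defensive.

Import Order.TTheory GRing.Theory Num.Theory.
Import numFieldNormedType.Exports.

Local Open Scope classical_set_scope.
Local Open Scope ring_scope.

(* The centres of the touching spheres lie at distance 2r from the centre c, and
   seen from c they have pairwise angles at least 2 phi, where
   sin phi = sec r / 2.  Hence the caps of angular radius phi around the
   corresponding directions in the tangent sphere S^(n-1) are disjoint, and
   their number N satisfies N * S(phi) <= S(pi), with S(x) the integral of sin^(n-2)
   over [0, x]; the substitution s = sin^2 t turns this into the bound by beta
   functions.

   The volume comparison is done without a surface measure.  A polynomial p in
   one variable that is close to the indicator function of t > cos phi satisfies
   sum_i p(<x, u_i>) <= 1 + N eps on the sphere, and what is needed is that this
   inequality may be averaged over x, the average of <x, u>^k over the unit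
   sphere being |u|^k times an explicit constant.  So it suffices to know that
   the functional sending <x, u>^k to |u|^k times that constant is positive,
   which goes by induction on the dimension. *)

(** * Integrals over segments: finite sums and antiderivatives *)

Section SegmentIntegral.
Context {R : realType}.
Notation mu := (@lebesgue_measure R).
Implicit Types (f F : R -> R) (a b : R).

Lemma continuous_integrable_segment f a b :
  continuous f -> mu.-integrable `[a, b] (EFin \o f).
Proof.
move=> cf; apply: continuous_compact_integrable; first exact: segment_compact.
exact: continuous_subspaceT.
Qed.

Lemma Rintegral_sum_segment (I : Type) (s : seq I) (f : I -> R -> R) a b :
  (forall i, continuous (f i)) ->
  \int[mu]_(t in `[a, b]) (\sum_(i <- s) f i t) =
  \sum_(i <- s) \int[mu]_(t in `[a, b]) f i t.
Proof.
move=> cf; elim: s => [|i s IH].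
  rewrite big_nil; under eq_Rintegral do rewrite big_nil.
  by rewrite Rintegral_cst// mul0r.
rewrite big_cons -IH; under eq_Rintegral do rewrite big_cons.
rewrite RintegralD//; first exact: continuous_integrable_segment.
apply: continuous_integrable_segment => x.
by apply: cvg_big => [|j _]; [exact: add_continuous|exact: cf].
Qed.

Lemma Rintegral_derive f F a b : a <= b -> continuous f ->
  (forall x : R, is_derive x 1 F (f x)) ->
  \int[mu]_(t in `[a, b]) f t = F b - F a.
Proof.
rewrite le_eqVlt => /predU1P[<- _ _|ab cf dF].
  by rewrite set_itv1 Rintegral_set1 subrr.
have cF : continuous F.
  by move=> x; apply/differentiable_continuous/derivable1_diffP; case: (dF x).
rewrite /Rintegral (@continuous_FTC2 _ f F)//.
- exact: continuous_subspaceT.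
- split.
  + by move=> x _; case: (dF x).
  + by apply: cvg_at_right_filter; exact: cF.
  + by apply: cvg_at_left_filter; exact: cF.
- by move=> x _; rewrite derive1E; apply: derive_val.
Qed.

End SegmentIntegral.

(** * Reduction formulas for the integrals of cos^a sin^b over [0, pi] *)

Section TrigMoments.
Context {R : realType}.
Notation mu := (@lebesgue_measure R).
Implicit Types a b m : nat.

Lemma continuous_trig_monomial a b :
  continuous (fun t : R => cos t ^+ a * sin t ^+ b).
Proof.
move=> x; apply: cvgM.
  exact: (continuous_comp (@continuous_cos R x) (@exprn_continuous R a _)).
exact: (continuous_comp (@continuous_sin R x) (@exprn_continuous R b _)).
Qed.

Lemma continuous_sinX m : continuous (fun t : R => sin t ^+ m).
Proof.
move=> x.
exact: (continuous_comp (@continuous_sin R x) (@exprn_continuous R m _)).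
Qed.

Definition trig_moment a b : R :=
  \int[mu]_(t in `[0, pi]) (cos t ^+ a * sin t ^+ b).

(** Integrate the derivative of cos^a sin^(b+1): the boundary terms vanish because the sine does at
    0 and pi. For a = 0 the truncated [a.-1] is harmless, its coefficient being 0. *)
Lemma trig_moment_rec a b :
  b.+1%:R * trig_moment a.+1 b = a%:R * trig_moment a.-1 b.+2.
Proof.
have dF (x : R) : is_derive x 1 (fun t => cos t ^+ a * sin t ^+ b.+1)
    (b.+1%:R * (cos x ^+ a.+1 * sin x ^+ b) -
     a%:R * (cos x ^+ a.-1 * sin x ^+ b.+2)).
  have -> : (fun t : R => cos t ^+ a * sin t ^+ b.+1) =
      (@cos R : R -> R) ^+ a * (@sin R : R -> R) ^+ b.+1.
    by apply/funext => t; rewrite !fctE.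
  apply: is_derive_eq; rewrite /GRing.scale/= !fctE !exprS; ring.
have cont (c : R) i j : continuous (fun t : R => c * (cos t ^+ i * sin t ^+ j)).
  by move=> x; apply: cvgM; [exact: cvg_cst|exact: continuous_trig_monomial].
have := @Rintegral_derive _ _ _ _ _ (@pi_ge0 R) _ dF.
rewrite sinpi sin0 exprS mul0r !mulr0 subrr RintegralB//; last 2 first.
- exact/continuous_integrable_segment/cont.
- exact/continuous_integrable_segment/cont.
rewrite !RintegralZl//; last 2 first.
- exact/continuous_integrable_segment/continuous_trig_monomial.
- exact/continuous_integrable_segment/continuous_trig_monomial.
move=> /(_ _)/eqP; rewrite subr_eq0 => H; apply/eqP/H => x.
by apply: cvgB; exact: cont.
Qed.

Lemma trig_momentD a b :
  trig_moment a.+2 b + trig_moment a b.+2 = trig_moment a b.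
Proof.
rewrite /trig_moment -RintegralD//; last 2 first.
- exact/continuous_integrable_segment/continuous_trig_monomial.
- exact/continuous_integrable_segment/continuous_trig_monomial.
apply: eq_Rintegral => t _.
by rewrite -[RHS]mulr1 -(cos2Dsin2 t) !exprS; ring.
Qed.

End TrigMoments.

(** * Moments of a coordinate on spheres of consecutive dimensions *)

Section SphereMoments.
Context {R : realType}.
Implicit Types (b d k p q s : nat).

Lemma trig_moment_sinSS a b :
  (a + b.+2)%:R * trig_moment a b.+2 = b.+1%:R * trig_moment a b :> R.
Proof.
rewrite -[trig_moment a b]trig_momentD mulrDr trig_moment_rec/= -mulrDl -natrD.
by rewrite addSnnS addnC.
Qed.

Lemma trig_moment_cosSS a b :
  (a + b.+2)%:R * trig_moment a.+2 b = a.+1%:R * trig_moment a b :> R.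
Proof.
rewrite -[in RHS]trig_momentD mulrDr -trig_moment_rec -mulrDl -natrD.
by rewrite addSnnS.
Qed.

Lemma trig_moment_odd a b : odd a -> trig_moment a b = 0 :> R.
Proof.
elim/ltn_ind: a b => -[//|[|a]] IH b /=.
  move=> _; have := @trig_moment_rec R 0 b; rewrite mul0r => /eqP.
  by rewrite mulf_eq0 pnatr_eq0 => /eqP.
rewrite negbK => oa; have := @trig_moment_rec R a.+1 b.
by rewrite /= (IH a)// mulr0 => /eqP; rewrite mulf_eq0 pnatr_eq0 => /eqP.
Qed.

(* The double factorial [(2 p - 1)!!] is [step2_prod 1 p]. *)
Definition step2_prod d p : nat := (\prod_(i < p) (d + i.*2))%N.

Lemma step2_prodS d p : step2_prod d p.+1 = (step2_prod d p * (d + p.*2))%N.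
Proof. by rewrite /step2_prod big_ord_recr. Qed.

Lemma step2_prod_gt0 d p : (0 < d)%N -> (0 < step2_prod d p)%N.
Proof. by move=> d0; rewrite prodn_gt0// => i; rewrite addn_gt0 d0. Qed.

Lemma step2_prod1_fact p : (step2_prod 1 p * (2 ^ p * p`!) = p.*2`!)%N.
Proof.
elim: p => [|p IH]; first by rewrite /step2_prod big_ord0.
rewrite step2_prodS doubleS !factS -IH expnS add1n.
have -> : (p.*2.+2 = 2 * p.+1)%N by lia.
by ring.
Qed.

(** Both binomials are quotients of factorials and (2p)! = (2p-1)!! 2^p p!; the powers of 2
    cancel. *)
Lemma bin_step2_prod p q : (q <= p)%N ->
  ('C(p.*2, q.*2) * step2_prod 1 q * step2_prod 1 (p - q) =
   'C(p, q) * step2_prod 1 p)%N.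
Proof.
move=> qp; have H := @bin_fact p.*2 q.*2; have := @bin_fact p q qp.
move: H; rewrite leq_double qp -doubleB -!step2_prod1_fact => /(_ isT) H1 H2.
have e : (2 ^ p = 2 ^ q * 2 ^ (p - q))%N by rewrite -expnD subnKC.
apply/eqP; rewrite -(@eqn_pmul2r (2 ^ p * (q`! * (p - q)`!))); last first.
  by rewrite !muln_gt0 expn_gt0 !fact_gt0.
apply/eqP.
transitivity (step2_prod 1 p * (2 ^ p * p`!))%N; last by rewrite -H2; lia.
by rewrite -H1 e; lia.
Qed.

Lemma trig_moment_even b p q :
  (step2_prod b.+2 (p + q))%:R * trig_moment p.*2 (b + q.*2) =
  (step2_prod 1 p * step2_prod b.+1 q)%:R * trig_moment 0 b :> R.
Proof.
elim: p => [|p IH].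
  rewrite add0n; elim: q => [|q IH].
    by rewrite /step2_prod !big_ord0 addn0 mul1r.
  have := trig_moment_sinSS 0 (b + q.*2).
  rewrite !step2_prodS doubleS add0n !addnS !addSn !natrM => E.
  move: IH; rewrite double0 natrM => IH.
  by rewrite -[LHS]mulrA E [LHS]mulrCA IH; ring.
have := trig_moment_cosSS p.*2 (b + q.*2).
rewrite !addSn !step2_prodS doubleS !natrM => E.
have {}E : (b.+2 + (p + q).*2)%:R * trig_moment p.*2.+2 (b + q.*2) =
    (1 + p.*2)%:R * trig_moment p.*2 (b + q.*2) :> R.
  by rewrite add1n -E doubleD; congr (_%:R * _); lia.
by rewrite -mulrA E mulrCA IH natrM; ring.
Qed.

(* The [k]-th moment of a coordinate under the uniform probability measure on
   the unit sphere of [R^d], as given by its closed form; the measure itself is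
   never constructed. *)
Definition sphere_moment d k : R :=
  if odd k then 0 else (step2_prod 1 k./2)%:R / (step2_prod d k./2)%:R.

Lemma sum_even_terms (f : nat -> R) p : (forall q, f q.*2.+1 = 0) ->
  \sum_(j < p.*2.+1) f j = \sum_(q < p.+1) f q.*2.
Proof.
move=> f0; elim: p => [|p IH]; first by rewrite !big_ord_recr !big_ord0.
by rewrite doubleS 2!big_ord_recr/= IH f0 addr0 [RHS]big_ord_recr/= doubleS.
Qed.

(** Links the moments in R^(b+1) to those in R^(b+2). With x the first coordinate of a vector and y
    the squared length of its tail v, the left side expands the k-th power of x cos t + sin t <w, v>
    and averages it first over w in the smaller sphere, then over t with weight sin^b t. *)
Lemma sphere_momentS b k (x y : R) :
  \sum_(j < k.+1) 'C(k, j)%:R * x ^+ (k - j) * y ^+ j./2 *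
     sphere_moment b.+1 j * trig_moment (k - j) (b + j) =
  (x ^+ 2 + y) ^+ k./2 * sphere_moment b.+2 k * trig_moment 0 b.
Proof.
have [ok|ek] := boolP (odd k).
  (* For odd k one of j and k - j is odd, so every term has a vanishing factor. *)
  rewrite [in RHS]/sphere_moment ok mulr0 mul0r big1// => j _.
  rewrite /sphere_moment; case: ifPn => [_|oj]; first by rewrite mulr0 mul0r.
  have jk : (j <= k)%N by rewrite -ltnS.
  by rewrite trig_moment_odd ?mulr0// oddB// ok (negbTE oj).
have [p ->] : exists p, k = p.*2 by exists k./2; rewrite even_halfK.
pose f j : R := 'C(p.*2, j)%:R * x ^+ (p.*2 - j) * y ^+ j./2 *
     sphere_moment b.+1 j * trig_moment (p.*2 - j) (b + j).
rewrite (@sum_even_terms f) => [|q]; last first.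
  by rewrite /f /sphere_moment /= odd_double mulr0 mul0r.
rewrite /sphere_moment odd_double doubleK exprDn !mulr_suml.
apply: eq_bigr => -[q /= qp] _; rewrite /f /sphere_moment odd_double doubleK.
have xE : x ^+ (p - q).*2 = (x ^+ 2) ^+ (p - q) by rewrite -mul2n exprM.
rewrite -doubleB xE -mulr_natl.
have := trig_moment_even b (p - q) q; rewrite subnK//.
have := bin_step2_prod (qp : (q <= p)%N) => /(congr1 (fun n => n%:R : R)).
rewrite !natrM.
have n1 : (step2_prod b.+1 q)%:R != 0 :> R by rewrite pnatr_eq0 -lt0n step2_prod_gt0.
have n2 : (step2_prod b.+2 p)%:R != 0 :> R by rewrite pnatr_eq0 -lt0n step2_prod_gt0.
move: n1 n2.
set A := (step2_prod b.+1 q)%:R; set B := (step2_prod b.+2 p)%:R.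
set J := trig_moment _ _; set J0 := trig_moment _ _ => n1 n2 E1 E2.
have -> : J = (step2_prod 1 (p - q))%:R * A * J0 / B by rewrite -E2; field.
set M := (step2_prod 1 q)%:R; set N := (step2_prod 1 (p - q))%:R.
transitivity ('C(p.*2, q.*2)%:R * M * N * (x ^+ 2 ^+ (p - q) * y ^+ q * J0 / B)).
  by field; rewrite n1 n2.
by rewrite E1 -mulr_natl; ring.
Qed.

(** A summation range independent of k, so that the sums over j and k can be exchanged; the added
    binomials are 0. *)
Lemma sphere_momentS_widen b k K (x y : R) : (k < K)%N ->
  \sum_(j < K) 'C(k, j)%:R * x ^+ (k - j) * y ^+ j./2 *
     sphere_moment b.+1 j * trig_moment (k - j) (b + j) =
  (x ^+ 2 + y) ^+ k./2 * sphere_moment b.+2 k * trig_moment 0 b.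
Proof.
move=> kK; rewrite -sphere_momentS.
rewrite (big_ord_widen _ (fun j => 'C(k, j)%:R * x ^+ (k - j) * y ^+ j./2 *
     sphere_moment b.+1 j * trig_moment (k - j) (b + j)) kK) [RHS]big_mkcond/=.
apply: eq_bigr => j _; case: ltnP => // kj.
by rewrite bin_small// !mul0r.
Qed.

Lemma exprD_widen k K (x y : R) : (k < K)%N ->
  (x + y) ^+ k = \sum_(j < K) 'C(k, j)%:R * x ^+ (k - j) * y ^+ j.
Proof.
move=> kK; rewrite exprDn.
rewrite (big_ord_widen _ (fun j => x ^+ (k - j) * y ^+ j *+ 'C(k, j)) kK) big_mkcond/=.
apply: eq_bigr => j _; case: ltnP => // kj; first by rewrite -mulr_natl mulrA.
by rewrite bin_small// !mul0r.
Qed.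

Lemma trig_moment_sin_gt0 b : 0 < trig_moment 0 b :> R.
Proof.
elim/ltn_ind: b => -[_|[_|b IH]].
- rewrite /trig_moment (_ : (fun=> _) = cst 1); last first.
    by apply/funext => t /=; rewrite !expr0 mulr1.
  rewrite Rintegral_cst//= lebesgue_measure_itv/= lte_fin pi_gt0 sube0 mul1r.
  exact: pi_gt0.
- have -> : trig_moment 0 1 = 2 :> R.
    transitivity (- cos pi - - cos 0 :> R); last by rewrite cospi cos0; ring.
    rewrite /trig_moment; under eq_Rintegral do rewrite expr0 mul1r expr1.
    apply: (@Rintegral_derive _ _ (fun t => - cos t)).
    + exact: pi_ge0.
    + exact: continuous_sin.
    + by move=> x; apply: is_derive_eq; rewrite opprK.
  by [].
- have := trig_moment_sinSS 0 b; rewrite add0n => E.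
  have : 0 < b.+2%:R * trig_moment 0 b.+2 :> R by rewrite E mulr_gt0// IH.
  by rewrite pmulr_rgt0.
Qed.

End SphereMoments.

(** * Positivity of averaging over the sphere *)

Section SpherePositivity.
Context {R : realType}.

Definition vcons n (a : R) (y : 'rV[R]_n.+1) : 'rV[R]_n.+2 :=
  \row_j oapp (y ord0) a (unlift ord0 j).

Definition vtail n (u : 'rV[R]_n.+2) : 'rV[R]_n.+1 :=
  \row_j u ord0 (lift ord0 j).

Lemma dot_recl n (x y : 'rV[R]_n.+2) :
  dot x y = x ord0 ord0 * y ord0 ord0 + dot (vtail x) (vtail y).
Proof.
by rewrite /dot big_ord_recl; congr (_ + _); apply: eq_bigr => i _; rewrite !mxE.
Qed.

Lemma vcons0 n a (y : 'rV[R]_n.+1) : vcons a y ord0 ord0 = a.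
Proof. by rewrite mxE unlift_none. Qed.

Lemma vtail_vcons n a (y : 'rV[R]_n.+1) : vtail (vcons a y) = y.
Proof. by apply/rowP => j; rewrite !mxE liftK. Qed.

Lemma dotC n (x y : 'rV[R]_n.+1) : dot x y = dot y x.
Proof. by apply: eq_bigr => i _; rewrite mulrC. Qed.

Lemma dotZl n a (x y : 'rV[R]_n.+1) : dot (a *: x) y = a * dot x y.
Proof.
by rewrite /dot mulr_sumr; apply: eq_bigr => i _; rewrite mxE mulrA.
Qed.

(* Averaging over the sphere of [R^(n+1)] is a positive functional.  In
   dimension [n + 2] write a point as [(cos t, sin t * y)] with [y] on the
   smaller sphere, apply the induction hypothesis for each fixed [t] and
   integrate the resulting inequality against [sin t ^ n] over [0, pi]. *)
Lemma sphere_moment_nonneg n (I : finType) K (c : I -> nat -> R)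
    (u : I -> 'rV[R]_n.+1) :
  (forall x, dot x x = 1 -> 0 <= \sum_i \sum_(k < K) c i k * dot x (u i) ^+ k) ->
  0 <= \sum_i \sum_(k < K)
         c i k * dot (u i) (u i) ^+ k./2 * sphere_moment n.+1 k.
Proof.
elim: n I K c u => [|n IH] I K c u pos.
  (* The sphere of R^1 consists of 1 and -1: in the half sum of the two inequalities the odd powers
     cancel, and [sphere_moment 1 k] is 1 for even k. *)
  have dot1 (s : R) (v : 'rV[R]_1) : dot (const_mx s) v = s * v ord0 ord0.
    by rewrite /dot big_ord_recl big_ord0 addr0 mxE.
  have p1 : 0 <= \sum_i \sum_(k < K) c i k * (1 * u i ord0 ord0) ^+ k.
    have := pos (const_mx 1); rewrite dot1 mxE mul1r => /(_ erefl).
    by under eq_bigr do under eq_bigr do rewrite dot1.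
  have pN1 : 0 <= \sum_i \sum_(k < K) c i k * (-1 * u i ord0 ord0) ^+ k.
    have := pos (const_mx (-1)); rewrite dot1 mxE mulrNN mul1r => /(_ erefl).
    by under eq_bigr do under eq_bigr do rewrite dot1.
  have : 0 <= (\sum_i \sum_(k < K) c i k * (1 * u i ord0 ord0) ^+ k +
      \sum_i \sum_(k < K) c i k * (-1 * u i ord0 ord0) ^+ k) / 2.
    by rewrite divr_ge0// addr_ge0.
  rewrite -big_split/= mulr_suml; congr (_ <= _); apply: eq_bigr => i _.
  rewrite -big_split/= mulr_suml; apply: eq_bigr => k _.
  rewrite /dot big_ord_recl big_ord0 addr0 /sphere_moment mul1r mulN1r exprNn.
  case: ifPn => ok; first by rewrite -signr_odd ok expr1 mulN1r; ring.
  rewrite -signr_odd (negbTE ok) divff ?pnatr_eq0 -?lt0n ?step2_prod_gt0//.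
  by rewrite -expr2 -exprM mul2n even_halfK//; field.
pose a i := u i ord0 ord0; pose rho i := dot (vtail (u i)) (vtail (u i)).
(* The coefficient of the j-th power of <y, tail of [u i]> once the hypothesis at (cos t, sin t y)
   is expanded. *)
pose coef t i j :=
  \sum_(k < K) c i k * 'C(k, j)%:R * (a i * cos t) ^+ (k - j) * sin t ^+ j.
have slice t : 0 <= \sum_i \sum_(j < K)
    coef t i j * rho i ^+ j./2 * sphere_moment n.+1 j.
  apply: IH => y yy.
  have := pos (vcons (cos t) (sin t *: y)).
  rewrite dot_recl vcons0 vtail_vcons dotZl dotC dotZl yy mulr1 -!expr2 cos2Dsin2.
  move=> /(_ erefl); congr (_ <= _); apply: eq_bigr => i _.
  rewrite /coef; under [RHS]eq_bigr do rewrite mulr_suml.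
  rewrite [RHS]exchange_big/=; apply: eq_bigr => k _.
  rewrite dot_recl vcons0 vtail_vcons dotZl (exprD_widen _ _ (ltn_ord k)) mulr_sumr.
  by apply: eq_bigr => j _; rewrite /a !exprMn; ring.
pose D i j k := c i k * 'C(k, j)%:R * a i ^+ (k - j) *
  rho i ^+ j./2 * sphere_moment n.+1 j.
have contD i j k :
    continuous (fun t : R => D i j k * (cos t ^+ (k - j) * sin t ^+ (n + j))).
  by move=> t; apply: cvgM; [exact: cvg_cst|exact: continuous_trig_monomial].
have contS (J : Type) (s : seq J) (f : J -> R -> R) :
    (forall i, continuous (f i)) ->
    continuous (fun t => \sum_(i <- s) f i t).
  by move=> cf t; apply: cvg_big => [|i _]; [exact: add_continuous|exact: cf].
have : 0 <= \int[@lebesgue_measure R]_(t in `[0, pi])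
    (\sum_i \sum_(j < K) \sum_(k < K)
       D i j k * (cos t ^+ (k - j) * sin t ^+ (n + j))).
  apply: Rintegral_ge0 => t /=; rewrite in_itv/= => t0pi.
  have := mulr_ge0 (slice t) (exprn_ge0 n (sin_ge0_pi t0pi)).
  congr (_ <= _); rewrite mulr_suml; apply: eq_bigr => i _.
  rewrite mulr_suml; apply: eq_bigr => j _.
  rewrite /coef !mulr_suml; apply: eq_bigr => k _.
  by rewrite /D !exprMn exprD; ring.
rewrite Rintegral_sum_segment; last first.
  by move=> i; apply: (contS) => j; apply: (contS) => k; exact: contD.
under eq_bigr => i _.
  rewrite Rintegral_sum_segment; last by move=> j; apply: (contS) => k; exact: contD.
  under eq_bigr => j _.
    rewrite Rintegral_sum_segment; last by move=> k; exact: contD.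
    under eq_bigr => k _.
      rewrite RintegralZl//; last first.
        exact/continuous_integrable_segment/continuous_trig_monomial.
      rewrite -/(trig_moment _ _).
      over.
    over.
  rewrite exchange_big/=.
  under eq_bigr => k _.
    rewrite (_ : \sum_(j < K) _ = c i k * \sum_(j < K) 'C(k, j)%:R * a i ^+ (k - j) *
      rho i ^+ j./2 * sphere_moment n.+1 j * trig_moment (k - j) (n + j)); last first.
      by rewrite mulr_sumr; apply: eq_bigr => j _; rewrite /D; ring.
    (* The sum over j collapses to the term wanted in the larger dimension, times the positive
       factor [trig_moment 0 n] common to all i and k. *)
    rewrite (sphere_momentS_widen _ _ _ (ltn_ord k)) !mulrA.
    rewrite (_ : a i ^+ 2 + rho i = dot (u i) (u i)); last by rewrite dot_recl expr2.
    over.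
  rewrite -mulr_suml.
  over.
by rewrite -mulr_suml pmulr_lge0// trig_moment_sin_gt0.
Qed.

End SpherePositivity.

(** * Polynomials close to a step function on [-1, 1] *)

Section StepPolynomial.
Context {R : realType}.
Implicit Types (y t : R) (K : nat).

Lemma one_sub_expr_le K y : 0 <= y <= 1 -> 1 - (1 - y) ^+ K <= K%:R * y.
Proof.
move=> /andP[y0 y1]; elim: K => [|K IH]; first by rewrite expr0 mul0r subrr.
have : (1 - y) ^+ K <= 1 by rewrite exprn_ile1; lra.
rewrite exprS -natr1 => h.
have : 0 <= y * (1 - (1 - y) ^+ K) by rewrite mulr_ge0// subr_ge0.
lra.
Qed.

(** Induction on K, from (1 - y) (1 + (K+1) y) <= 1 + K y. *)
Lemma expr_one_sub_le K y : 0 <= y <= 1 -> (1 - y) ^+ K * (1 + K%:R * y) <= 1.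
Proof.
move=> /andP[y0 y1]; elim: K => [|K IH]; first by rewrite expr0 mul0r addr0 mulr1.
apply: le_trans IH; rewrite exprSr -mulrA ler_wpM2l ?exprn_ge0 ?subr_ge0//.
rewrite -natr1.
have : 0 <= (K%:R + 1) * y ^+ 2 by rewrite mulr_ge0 ?sqr_ge0// natr1 ler0n.
by rewrite expr2; lra.
Qed.

(* Witness: [1 - (1 - ((1 + t) / 2) ^ n) ^ K] with [K] of the order of
   [1 / (eps * ((1 + sigma) / 2) ^ n)] and [n] large. *)
Lemma step_polynomial (tau sigma eps : R) :
  0 <= tau -> tau < sigma -> sigma <= 1 -> 0 < eps < 1 ->
  exists q : {poly R}, forall t, -1 <= t <= 1 ->
    [/\ 0 <= q.[t] <= 1, t <= tau -> q.[t] <= eps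
      & sigma <= t -> 1 - eps <= q.[t]].
Proof.
move=> tau0 ts sig1 /andP[eps0 eps1].
pose s1 := (1 + tau) / 2; pose s2 := (1 + sigma) / 2.
have s1_gt0 : 0 < s1 by rewrite /s1; lra.
have s12 : s1 < s2 by rewrite /s1 /s2; lra.
have s2_gt0 : 0 < s2 by exact: lt_trans s12.
have s1s2 : 0 <= s1 / s2 by rewrite divr_ge0// ltW.
(* With z = 1 / (eps s2^n) this margin makes z s1^n < eps / 2; rounding z up to K adds at most s1^n,
   which is at most z s1^n. *)
have [n nP] : exists n, (s1 / s2) ^+ n < eps ^+ 2 / 2.
  have : (s1 / s2) ^+ n @[n --> \oo] --> (0 : R).
    by apply: cvg_expr; rewrite ger0_norm// ltr_pdivrMr// mul1r.
  move=> /cvgrPdist_lt/(_ (eps ^+ 2 / 2)) [|N _ /(_ N (leqnn N))].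
    by rewrite divr_gt0// exprn_gt0.
  rewrite /= sub0r normrN ger0_norm ?exprn_ge0// => ?.
  by exists N.
pose z := (eps * s2 ^+ n)^-1; pose K := (Num.truncn z).+1.
have s2n : 0 < s2 ^+ n by rewrite exprn_gt0.
have z_gt0 : 0 < z by rewrite invr_gt0 mulr_gt0.
have zK : z < K%:R by rewrite truncnS_gt.
have Kz : K%:R <= z + 1 by rewrite -natr1 lerD2r truncn_le// ltW.
exists (1 - (1 - ((2^-1)%:P * (1 + 'X)) ^+ n) ^+ K) => t t1.
have -> : (1 - (1 - ((2^-1)%:P * (1 + 'X)) ^+ n) ^+ K).[t] =
    1 - (1 - ((1 + t) / 2) ^+ n) ^+ K.
  by rewrite !(hornerE, horner_exp) mulrC.
set x := (1 + t) / 2; have x01 : 0 <= x <= 1 by rewrite /x; lra.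
have [x0 x1] := andP x01.
have y01 : 0 <= x ^+ n <= 1 by rewrite exprn_ge0//= exprn_ile1.
have [y0 y1] := andP y01.
split.
- rewrite subr_ge0 exprn_ile1/= ?lerBlDr ?lerDl ?exprn_ge0//; lra.
- move=> tt; apply: le_trans (one_sub_expr_le K y01) _.
  have xs1 : x ^+ n <= s1 ^+ n by apply: lerXn2r; rewrite ?nnegrE /x /s1; lra.
  have : z * s1 ^+ n < eps / 2.
    have -> : z * s1 ^+ n = (s1 / s2) ^+ n / eps.
      by rewrite /z [(s1 / s2) ^+ n]expr_div_n invfM; ring.
    by rewrite ltr_pdivrMr// (lt_le_trans nP)// expr2 mulrAC lexx.
  have : s1 ^+ n <= z * s1 ^+ n.
    rewrite ler_peMl ?exprn_ge0 ?(ltW s1_gt0)// -invr1 lef_pV2 ?posrE ?mulr_gt0//.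
    by rewrite mulr_ile1 ?exprn_ile1 ?(ltW eps0) ?(ltW eps1) ?(ltW s2n)//; rewrite /s2; lra.
  have : K%:R * x ^+ n <= (z + 1) * s1 ^+ n by rewrite ler_pM.
  by rewrite mulrDl mul1r; lra.
- move=> st; have := expr_one_sub_le K y01.
  have xs2 : s2 ^+ n <= x ^+ n by apply: lerXn2r; rewrite ?nnegrE /x /s2; lra.
  (* This forces (1 - x^n)^K <= eps for t >= sigma. *)
  have : eps^-1 <= K%:R * x ^+ n.
    have -> : eps^-1 = z * s2 ^+ n by rewrite /z invfM mulfVK ?gt_eqF.
    by rewrite ler_pM// ltW.
  set w := K%:R * _; set v := (1 - _) ^+ K => ew vw.
  have v0 : 0 <= v by rewrite exprn_ge0 ?subr_ge0.
  have : v * eps^-1 <= 1 by apply: le_trans vw; rewrite ler_wpM2l//; lra.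
  by rewrite ler_pdivrMr// mul1r; lra.
Qed.

End StepPolynomial.

(** * Averages over the sphere as sine-weighted integrals *)

Section SphereAverage.
Context {R : realType}.
Notation mu := (@lebesgue_measure R).

Lemma Rintegral_itv_le (f : R -> R) (a b : R) : continuous f -> 0 <= a <= b ->
  (forall t, a <= t <= b -> 0 <= f t) ->
  \int[mu]_(t in `[0, a]) f t <= \int[mu]_(t in `[0, b]) f t.
Proof.
move=> cf /andP[a0 ab] f0; rewrite -subr_ge0.
rewrite (@Rintegral_itvB _ f (BLeft 0) (BRight b) a) ?bnd_simp//; last first.
  exact: continuous_integrable_segment.
apply: Rintegral_ge0 => t /=; rewrite in_itv/= => /andP[at_ tb].
by rewrite f0// tb ltW.
Qed.

Lemma Rintegral_itvB_le (f : R -> R) (a b : R) : continuous f -> 0 <= a <= b ->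
  (forall t, a <= t <= b -> f t <= 1) ->
  \int[mu]_(t in `[0, b]) f t <= \int[mu]_(t in `[0, a]) f t + (b - a).
Proof.
move=> cf /andP[a0 ab] f1; rewrite -lerBlDl.
have intf : mu.-integrable `[0, b] (EFin \o f) by exact: continuous_integrable_segment.
rewrite (@Rintegral_itvB _ f (BLeft 0) (BRight b) a) ?bnd_simp//.
apply: (@le_trans _ _ (\int[mu]_(t in `]a, b]) (cst 1 t))).
  apply: le_Rintegral => //=.
  - by apply: integrableS intf => //; apply: subset_itvr; rewrite bnd_simp.
  - have intc : mu.-integrable `[a, b] (EFin \o cst (1 : R)).
      by apply: continuous_integrable_segment => ?; exact: cvg_cst.
    by apply: integrableS intc => //; exact: subset_itv_oc_cc.
  - by move=> t; rewrite in_itv/= => /andP[at_ tb]; rewrite f1// tb ltW.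
rewrite Rintegral_cst//= lebesgue_measure_itv/= lte_fin mul1r.
by case: ifPn => _ //=; rewrite subr_ge0.
Qed.

(** The closed form really is the normalized moment of cos t for the weight sin^b t on [0, pi], the
    law of a coordinate on the sphere of R^(b+2). *)
Lemma sphere_moment_trig b k :
  sphere_moment b.+2 k * trig_moment 0 b = trig_moment k b :> R.
Proof.
rewrite /sphere_moment; case: ifPn => [ok|ek].
  by rewrite mul0r trig_moment_odd.
have := @trig_moment_even R b k./2 0; rewrite addn0 even_halfK// double0 addn0.
rewrite /step2_prod big_ord0 muln1 -!/(step2_prod _ _) => E.
by rewrite mulrAC -E mulrAC divff ?mul1r// pnatr_eq0 -lt0n step2_prod_gt0.
Qed.

(** All unit directions contribute the same average, so N divides out and a single integral
    remains. *)
Lemma sum_polynomial_moment_nonneg m N (u : 'I_N -> 'rV[R]_m.+2) (p : {poly R}) :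
  (0 < N)%N -> (forall i, dot (u i) (u i) = 1) ->
  (forall x, dot x x = 1 -> 0 <= \sum_i p.[dot x (u i)]) ->
  0 <= \int[mu]_(t in `[0, pi]) (p.[cos t] * sin t ^+ m).
Proof.
move=> N0 u1 pos.
have /= := @sphere_moment_nonneg R m.+1 _ (size p) (fun _ k => p`_k) u.
under eq_bigr do under eq_bigr do rewrite u1 expr1n mulr1.
rewrite sumr_const card_ord -mulr_natl pmulr_rge0 ?ltr0n// => H.
have {}H : 0 <= \sum_(k < size p) p`_k * sphere_moment m.+2 k.
  apply: H => x xx; have := pos x xx; congr (_ <= _).
  by apply: eq_bigr => i _; rewrite horner_coef.
have := mulr_ge0 H (ltW (trig_moment_sin_gt0 m)).
congr (_ <= _); rewrite mulr_suml.
under [RHS]eq_Rintegral do rewrite horner_coef mulr_suml.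
have cont (k : nat) : continuous (fun t : R => p`_k * (cos t ^+ k * sin t ^+ m)).
  by move=> t; apply: cvgM; [exact: cvg_cst|exact: continuous_trig_monomial].
under [RHS]eq_Rintegral do under eq_bigr do rewrite -mulrA.
rewrite Rintegral_sum_segment; last by move=> k; exact: cont.
apply: eq_bigr => k _; rewrite RintegralZl//; last first.
  exact/continuous_integrable_segment/continuous_trig_monomial.
by rewrite -mulrA sphere_moment_trig.
Qed.

End SphereAverage.

(** * Bilinearity of the inner product and Cauchy-Schwarz *)

Section InnerProduct.
Context {R : realType} {n : nat}.
Implicit Types x y z : 'rV[R]_n.+1.

Lemma dotDl x y z : dot (x + y) z = dot x z + dot y z.
Proof.
by rewrite /dot -big_split/=; apply: eq_bigr => i _; rewrite mxE mulrDl.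
Qed.

Lemma dotNl x z : dot (- x) z = - dot x z.
Proof. by rewrite -scaleN1r dotZl mulN1r. Qed.

Lemma dotBl x y z : dot (x - y) z = dot x z - dot y z.
Proof. by rewrite dotDl dotNl. Qed.

Lemma dotDr x y z : dot z (x + y) = dot z x + dot z y.
Proof. by rewrite ![dot z _]dotC dotDl. Qed.

Lemma dotNr x z : dot z (- x) = - dot z x.
Proof. by rewrite ![dot z _]dotC dotNl. Qed.

Lemma dotBr x y z : dot z (x - y) = dot z x - dot z y.
Proof. by rewrite ![dot z _]dotC dotBl. Qed.

Lemma dotZr a x z : dot z (a *: x) = a * dot z x.
Proof. by rewrite ![dot z _]dotC dotZl. Qed.

Lemma dot_ge0 x : 0 <= dot x x.
Proof. by apply: sumr_ge0 => i _; rewrite -expr2 sqr_ge0. Qed.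

Lemma dot_eq0 x : dot x x = 0 -> x = 0.
Proof.
move=> /eqP; rewrite psumr_eq0 => [/allP h|i _]; last by rewrite -expr2 sqr_ge0.
apply/rowP => i; rewrite mxE; apply/eqP.
by have := h i; rewrite mem_index_enum mulf_eq0 orbb; exact.
Qed.

(** Read off from the squared length of y - <x, y> x. *)
Lemma sqr_dot_le_unit x y : dot x x = 1 -> dot x y ^+ 2 <= dot y y.
Proof.
move=> x1; have := dot_ge0 (y - dot x y *: x).
rewrite !(dotBl, dotBr, dotZl, dotZr) x1 [dot y x]dotC expr2; lra.
Qed.

Lemma dot_unit_itv x y : dot x x = 1 -> dot y y = 1 -> -1 <= dot x y <= 1.
Proof.
move=> x1 y1; have := sqr_dot_le_unit y x1; rewrite y1 expr2 => h.
by apply/andP; split; nra.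
Qed.

End InnerProduct.

(** * Packing of spherical caps *)

Section CapPacking.
Context {R : realType}.
Notation mu := (@lebesgue_measure R).

(** As 2 cos^2 phi - 1 = cos (2 phi), the directions are at angles at least 2 phi; the two integrals
    are the areas of a cap and of the sphere up to a common factor. *)
Lemma cap_packing m N (u : 'I_N -> 'rV[R]_m.+2) (phi : R) :
  0 <= phi <= pi / 2 -> (forall i, dot (u i) (u i) = 1) ->
  (forall i j, i != j -> dot (u i) (u j) <= 2 * cos phi ^+ 2 - 1) ->
  N%:R * \int[mu]_(t in `[0, phi]) (sin t ^+ m) <=
  \int[mu]_(t in `[0, pi]) (sin t ^+ m).
Proof.
move=> /andP[phi0 phipi] u1 sep.
have pi0 := @pi_gt0 R.
have csin := @continuous_sinX R m.
have sin0 (t : R) : 0 <= t <= pi -> 0 <= sin t ^+ m.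
  by move=> tpi; rewrite exprn_ge0// sin_ge0_pi.
have sin1 (t : R) : 0 <= t <= pi -> sin t ^+ m <= 1.
  by move=> tpi; rewrite exprn_ile1// ?sin_ge0_pi// sin_le1.
pose S (x : R) := \int[mu]_(t in `[0, x]) (sin t ^+ m).
rewrite -/(S phi) -/(S pi).
have S_ge0 x : x <= pi -> 0 <= S x.
  move=> xpi; apply: Rintegral_ge0 => t /=; rewrite in_itv/= => /andP[t0 tx].
  by rewrite sin0// t0 (le_trans tx).
case: N u u1 sep => [|N] u u1 sep; first by rewrite mul0r S_ge0.
pose tau := cos phi.
have tau0 : 0 <= tau by apply: cos_ge0_pihalf; lra.
(* The open caps are disjoint: for i != j, Cauchy-Schwarz with [u i + u j] would give (2 tau)^2 < 2
   + 2 <u i, u j> <= 4 tau^2. *)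
have one x : dot x x = 1 -> forall i j,
    tau < dot x (u i) -> tau < dot x (u j) -> i = j.
  move=> x1 i j xi xj; apply/eqP; case: eqVneq => // /sep uij.
  have := sqr_dot_le_unit (u i + u j) x1.
  rewrite !(dotDl, dotDr) !u1 [dot (u j) (u i)]dotC => h.
  have : (2 * tau) ^+ 2 < (dot x (u i) + dot x (u j)) ^+ 2.
    by rewrite ltrXn2r ?nnegrE//; lra.
  by rewrite exprMn -/tau in uij *; lra.
(* The comparison with an error e: the polynomial rises between cos phi and cos (phi - e). *)
have bound e : 0 < e -> e < 1 -> e < phi ->
    N.+1%:R * ((1 - e) * (S phi - e)) <= (1 + N.+1%:R * e) * S pi.
  move=> e0 e1 ephi; pose phi' := phi - e; pose sigma := cos phi'.
  have ts : tau < sigma by rewrite /tau /sigma ltr_cos ?in_itv/= /phi'; lra.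
  have [|q qP] := @step_polynomial R tau sigma e tau0 ts (cos_le1 _).
    by rewrite e0 e1.
  have cqs : continuous (fun t : R => q.[cos t] * sin t ^+ m).
    move=> x; apply: cvgM; last exact: csin.
    exact: (continuous_comp (@continuous_cos R x) (@continuous_horner R q _)).
  (* At most one inner product exceeds [tau] and contributes at most 1; every other one contributes
     at most e. *)
  have qbound x : dot x x = 1 -> \sum_i q.[dot x (u i)] <= 1 + N.+1%:R * e.
    move=> x1; have x_itv i : -1 <= dot x (u i) <= 1 by exact: dot_unit_itv.
    have [/existsP[i xi]|/existsPn none] := boolP [exists i, tau < dot x (u i)].
      rewrite (bigD1 i)//= lerD//; first by have [/andP[]] := qP _ (x_itv i).
      apply: (@le_trans _ _ (\sum_(j < N.+1 | j != i) e)).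
        apply: ler_sum => j ji; have [_ + _] := qP _ (x_itv j); apply.
        by rewrite leNgt; apply: contra ji => xj; rewrite (one x x1 _ _ xj xi).
      rewrite -[in leRHS](card_ord N.+1) mulr_natl -sumr_const.
      by rewrite [leRHS](bigD1 i)//= lerDr ltW.
    apply: (@le_trans _ _ (\sum_(j < N.+1) e)); last first.
      by rewrite sumr_const card_ord mulr_natl lerDr.
    apply: ler_sum => j _; have [_ + _] := qP _ (x_itv j); apply.
    by rewrite leNgt none.
  have cos_itv (t : R) : -1 <= cos t <= 1 by rewrite cos_geN1 cos_le1.
  have N0 : N.+1%:R != 0 :> R by rewrite pnatr_eq0.
  (* The constant spreads the bound of [qbound] evenly over the directions, so the values of p sum
     to something nonnegative. *)
  pose p : {poly R} := (N.+1%:R^-1 + e)%:P - q.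
  have := @sum_polynomial_moment_nonneg R m N.+1 u p isT u1.
  have : forall x, dot x x = 1 -> 0 <= \sum_i p.[dot x (u i)].
    move=> x /qbound; rewrite -subr_ge0; congr (_ <= _).
    under [RHS]eq_bigr do rewrite /p !hornerE.
    rewrite sumrB sumr_const card_ord; congr (_ - _).
    by rewrite -[RHS]mulr_natl mulrDr divff.
  move=> h /(_ h){h}.
  under eq_Rintegral do rewrite /p !hornerE mulrBl.
  rewrite RintegralB//; last 2 first.
  - apply: continuous_integrable_segment => x.
    by apply: cvgM; [exact: cvg_cst|exact: csin].
  - exact: continuous_integrable_segment.
  rewrite RintegralZl//; last exact: continuous_integrable_segment.
  rewrite -/(S pi) subr_ge0 => le1.
  have le2 : (1 - e) * S phi' <= \int[mu]_(t in `[0, pi]) (q.[cos t] * sin t ^+ m).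
    apply: (@le_trans _ _ (\int[mu]_(t in `[0, phi']) (q.[cos t] * sin t ^+ m))).
      rewrite -RintegralZl//; last exact: continuous_integrable_segment.
      apply: le_Rintegral => //.
      - apply: continuous_integrable_segment => x.
        by apply: cvgM; [exact: cvg_cst|exact: csin].
      - exact: continuous_integrable_segment.
      - move=> t; rewrite /= in_itv/= => /andP[t0 tphi].
        rewrite ler_wpM2r ?sin0//; first by rewrite /phi' in tphi; lra.
        have [_ _] := qP _ (cos_itv t); apply.
        move: (tphi); rewrite le_eqVlt => /predU1P[->//|lt_tphi]; apply/ltW.
        by rewrite /sigma ltr_cos ?in_itv//=; rewrite /phi' in tphi *; lra.
    apply: Rintegral_itv_le => //; first by rewrite /phi'; lra.
    move=> t; rewrite {1}/phi' => /andP[t0 tpi].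
    rewrite mulr_ge0//; last by rewrite sin0//; lra.
    by have [/andP[]] := qP _ (cos_itv t).
  have le3 : S phi <= S phi' + e.
    rewrite (_ : e = phi - phi'); last by rewrite /phi'; ring.
    apply: Rintegral_itvB_le => //; first by rewrite /phi'; lra.
  have : N.+1%:R * ((1 - e) * S phi') <= N.+1%:R * ((N.+1%:R^-1 + e) * S pi).
    by rewrite ler_pM2l ?ltr0n// (le_trans le2).
  have -> : N.+1%:R * ((N.+1%:R^-1 + e) * S pi) = (1 + N.+1%:R * e) * S pi.
    by rewrite mulrA mulrDr divff.
  apply: le_trans.
  by rewrite ler_pM2l ?ltr0n// ler_pM2l; lra.
have [->|phi_neq0] := eqVneq phi 0.
  by rewrite /S set_itv1 Rintegral_set1 mulr0 S_ge0.
have phi_gt0 : 0 < phi by lra.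
rewrite leNgt; apply/negP => lt.
(* [bound] rearranges to d + N.+1 e^2 <= C e, while e <= d / (C + 1) gives C e < d. *)
pose d := N.+1%:R * S phi - S pi.
pose C := N.+1%:R * (S phi + 1) + N.+1%:R * S pi.
have C0 : 0 <= C by rewrite addr_ge0// mulr_ge0// ?addr_ge0 ?S_ge0//; lra.
have d0 : 0 < d by rewrite subr_gt0.
pose e := Num.min (1 / 2) (Num.min (phi / 2) (d / (C + 1))).
have e0 : 0 < e by rewrite !lt_min !divr_gt0//; lra.
have e1 : e < 1 by rewrite gt_min; apply/orP; left; lra.
have ephi : e < phi by rewrite !gt_min; apply/orP; right; apply/orP; left; lra.
have : e <= d / (C + 1) by rewrite !ge_min lexx !orbT.
rewrite ler_pdivlMr ?ltr_wpDl// mulrDr mulr1 => eC.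
have := bound e e0 e1 ephi.
have : 0 <= N.+1%:R * (e * e) by rewrite mulr_ge0// mulr_ge0 ?ltW.
by rewrite /C /d in eC *; lra.
Qed.

End CapPacking.

(** * Change of variables on open intervals *)

Section ImproperSubstitution.
Context {R : realType}.
Notation mu := (@lebesgue_measure R).
Implicit Types (a b : R) (F G : R -> R).

(* [[shrink a b k, shrink b a k]] increases to [(a, b)]. *)
Definition shrink a b (k : nat) : R := a + (b - a) / k.+3%:R.

Lemma cvg_shrink a b : shrink a b @ \oo --> a.
Proof.
rewrite -[X in _ --> X]addr0; apply: cvgD; first exact: cvg_cst.
rewrite -[X in _ --> X](mulr0 (b - a)); apply: cvgM; first exact: cvg_cst.
apply: (@cvg_comp _ _ _ (fun k => k.+2)%N harmonic _ \oo); last exact: cvg_harmonic.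
exact: (cvg_addnl 2).
Qed.

Lemma shrink_itv a b k : a < b -> a < shrink a b k < b.
Proof.
move=> ab; rewrite ltrDl divr_gt0 ?subr_gt0//= -ltrBrDl.
by rewrite ltr_pdivrMr// ltr_pMr ?subr_gt0// ltr1n.
Qed.

Lemma shrinkN_itv a b k : a < b -> a < shrink b a k < b.
Proof.
move=> ab; have := shrink_itv k ab; rewrite /shrink -[a - b]opprB mulNr.
by set e := _ / _ => /andP[e1 e2]; apply/andP; split; lra.
Qed.

Lemma shrink_lt a b k : a < b -> shrink a b k < shrink b a k.
Proof.
move=> ab; rewrite /shrink.
(* Denominators starting at 3 move each end by at most a third of the length, so the ends never
   cross. *)
have : (b - a) / k.+3%:R <= (b - a) / 3.
  by rewrite ler_pM2l ?subr_gt0// lef_pV2 ?posrE// ler_nat.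
rewrite -[a - b]opprB mulNr; set e := _ / _ => he; lra.
Qed.

Lemma shrink_decr a b k l : a < b -> (k <= l)%N -> shrink a b l <= shrink a b k.
Proof.
by move=> ab kl; rewrite lerD2l ler_pM2l ?subr_gt0// lef_pV2 ?posrE// ler_nat.
Qed.

Lemma shrink_incr a b k l : a < b -> (k <= l)%N -> shrink b a k <= shrink b a l.
Proof.
move=> ab kl; rewrite lerD2l -[a - b]opprB !mulNr lerN2.
by rewrite ler_pM2l ?subr_gt0// lef_pV2 ?posrE// ler_nat.
Qed.

Lemma bigcup_shrink F a b : a < b -> continuous F ->
  {in `[a, b] &, {homo F : x y / x < y}} ->
  \bigcup_k `[F (shrink a b k), F (shrink b a k)]%classic = `]F a, F b[%classic.
Proof.
move=> ab cF incF; apply/seteqP; split => s.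
  move=> [k _] /=; rewrite !in_itv/= => /andP[s1 s2].
  have /andP[i1 i2] := shrink_itv k ab; have i3 := shrink_lt k ab.
  have /andP[i4 i5] := shrinkN_itv k ab.
  apply/andP; split.
    by apply: lt_le_trans s1; apply: incF; rewrite ?in_itv/= ?lexx//=; lra.
  by apply: le_lt_trans s2 _; apply: incF; rewrite ?in_itv/= ?lexx//=; lra.
rewrite /= in_itv/= => /andP[as_ sb].
have cva : F (shrink a b k) @[k --> \oo] --> F a.
  by apply: (continuous_cvg _ (cF a)); exact: cvg_shrink.
have cvb : F (shrink b a k) @[k --> \oo] --> F b.
  by apply: (continuous_cvg _ (cF b)); exact: cvg_shrink.
have [N _ /(_ N (leqnn N)) [h1 h2]] :=
  filterI (cvgr_lt _ cva _ as_) (cvgr_gt _ cvb _ sb).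
by exists N => //=; rewrite in_itv/= !ltW.
Qed.

(** G may blow up at the ends. By monotone convergence both sides are limits over the segments given
    by [shrink], and on each of these the substitution rule for closed intervals applies. *)
Lemma ge0_integration_by_substitution_oo F G a b : a < b ->
  {in `[a, b] &, {homo F : x y / x < y}} ->
  (forall x : R, derivable F x 1) -> continuous (derive1 F) ->
  (forall x : R, a < x < b -> 0 <= derive1 F x) ->
  measurable_fun setT G -> (forall s, 0 <= G s) ->
  {in `]F a, F b[, continuous G} ->
  (\int[mu]_(s in `]F a, F b[) (G s)%:E =
   \int[mu]_(t in `]a, b[) (((G \o F) * derive1 F)%R t)%:E)%E.
Proof.
move=> ab incF dF cF' F'0 mG G0 cG.
have cF : continuous F.
  by move=> x; apply/differentiable_continuous/derivable1_diffP.
have mF' : measurable_fun setT (derive1 F) by exact: continuous_measurable_fun.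
have mF : measurable_fun setT F by exact: continuous_measurable_fun.
rewrite -(bigcup_shrink ab cF incF)//.
rewrite -[X in (_ = \int[_]_(_ in X) _)%E](bigcup_shrink ab (F := id))//; last first.
  by move=> x; exact: cvg_id.
have in1 k := andP (shrink_itv k ab); have in2 k := andP (shrinkN_itv k ab).
have homoF x y : a <= x -> x <= y -> y <= b -> F x <= F y.
  move=> ax; rewrite le_eqVlt => /predU1P[->//|xy] yb.
  by apply/ltW/incF; rewrite ?in_itv/=; lra.
have lhs : (\int[mu]_(s in `[F (shrink a b k), F (shrink b a k)])
      (G s)%:E)%E @[k --> \oo] -->
    (\int[mu]_(s in \bigcup_k `[F (shrink a b k), F (shrink b a k)]%classic)
      (G s)%:E)%E.
  apply: ge0_nondecreasing_set_cvg_integral => //.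
  + move=> k l kl; rewrite subsetEset; apply: subset_itv; rewrite bnd_simp.
      have [? _] := in1 l; have [_ ?] := in1 k.
      by apply: homoF; [exact: ltW|exact: shrink_decr|exact: ltW].
    have [? _] := in2 k; have [_ ?] := in2 l.
    by apply: homoF; [exact: ltW|exact: shrink_incr|exact: ltW].
  + by move=> k; apply/measurable_EFinP; exact: measurable_funTS.
  + by move=> k x _; rewrite lee_fin.
have rhs : (\int[mu]_(t in `[shrink a b k, shrink b a k])
      (((G \o F) * derive1 F)%R t)%:E)%E @[k --> \oo] -->
    (\int[mu]_(t in \bigcup_k `[shrink a b k, shrink b a k]%classic)
      (((G \o F) * derive1 F)%R t)%:E)%E.
  apply: ge0_nondecreasing_set_cvg_integral => //.
    + move=> k l kl; rewrite subsetEset; apply: subset_itv; rewrite bnd_simp.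
      * exact: shrink_decr.
      * exact: shrink_incr.
    + move=> k; apply/measurable_EFinP/measurable_funTS; apply: measurable_funM => //.
      exact: measurableT_comp.
    + move=> k x; rewrite /= in_itv/= => /andP[x1 x2]; rewrite lee_fin.
      apply: mulr_ge0; first exact: G0.
      have [? _] := in1 k; have [_ ?] := in2 k.
      by apply: F'0; apply/andP; split; lra.
rewrite -(cvg_lim _ lhs)// -(cvg_lim _ rhs)//; congr (lim (_ @ \oo)).
apply/funext => k; have [i1 i2] := in1 k; have [i3 i4] := in2 k.
  apply: integration_by_substitution_increasing.
  + exact/ltW/shrink_lt.
  + move=> x y; rewrite !in_itv/= => /andP[? ?] /andP[? ?] xy.
    by apply: incF => //; rewrite in_itv/=; lra.
  + by move=> x _; exact: cF'.
  + by apply/cvg_ex; exists (derive1 F (shrink a b k)); exact/cvg_at_right_filter/cF'.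
  + by apply/cvg_ex; exists (derive1 F (shrink b a k)); exact/cvg_at_left_filter/cF'.
  + split.
    * by move=> x _; exact: dF.
    * exact/cvg_at_right_filter/cF.
    * exact/cvg_at_left_filter/cF.
  + apply: continuous_in_subspaceT => s /set_mem/=; rewrite in_itv/= => /andP[s1 s2].
    apply: cG; rewrite in_itv/=; apply/andP; split.
      by apply: lt_le_trans s1; apply: incF; rewrite ?in_itv/=; lra.
    by apply: le_lt_trans s2 _; apply: incF; rewrite ?in_itv/=; lra.
Qed.

End ImproperSubstitution.

(** * Beta functions as integrals of powers of the sine *)

Section BetaSine.
Context {R : realType}.
Notation mu := (@lebesgue_measure R).

Lemma continuous_powR_gt0 (p x : R) : 0 < x -> {for x, continuous (@powR R ^~ p)}.
Proof.
move=> x0; apply/differentiable_continuous/derivable1_diffP.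
by apply: derivable_powR; rewrite in_itv/= andbT.
Qed.

(** Substitute s = sin^2 t: the exponents of s and 1 - s are (m - 1)/2 and -1/2, so the integrand
    becomes sin^(m-1) t / cos t times the derivative 2 sin t cos t. *)
Lemma incomplete_beta_sin m (phi : R) : 0 < phi <= pi / 2 ->
  incomplete_beta (sin phi ^+ 2) ((m.+2%:R - 1) / 2) (1 / 2) =
  2 * \int[mu]_(t in `[0, phi]) (sin t ^+ m).
Proof.
move=> /andP[phi0 phipi]; have pi0 := @pi_gt0 R.
pose y : R := (m.+2%:R - 1) / 2 - 1; pose z : R := 1 / 2 - 1.
pose F (t : R) := sin t ^+ 2; pose G (s : R) := s `^ y * (1 - s) `^ z.
have dF (t : R) : is_derive t 1 F (2 * sin t * cos t).
  rewrite (_ : F = (@sin R : R -> R) ^+ 2); last by apply/funext => ?; rewrite !fctE.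
  by apply: is_derive_eq; rewrite /GRing.scale/= expr1; ring.
have dFE : derive1 F = fun t => 2 * sin t * cos t.
  by apply/funext => t; rewrite derive1E; apply: derive_val.
have csin := @continuous_sinX R m.
have mG : measurable_fun setT G.
  apply: measurable_funM; first exact: measurable_powR.
  apply: (measurableT_comp (measurable_powR z)) => //.
  by apply: measurable_funB => //; exact: measurable_cst.
have G0 s : 0 <= G s by rewrite mulr_ge0 ?powR_ge0.
have F0 : F 0 = 0 by rewrite /F sin0 expr0n.
have trig (t : R) : 0 < t < phi -> 0 < sin t /\ 0 < cos t.
  by move=> /andP[t0 tphi]; split; [apply: sin_gt0_pihalf|apply: cos_gt0_pihalf]; lra.
have GF (t : R) : 0 < t < phi -> G (F t) * derive1 F t = 2 * sin t ^+ m.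
  move=> /trig[s0 c0]; rewrite dFE /G /F -(cos2sin2 t) -!(powR_mulrn 2) ?ltW// -!powRrM.
  have -> : 2%:R * z = - 1 by rewrite /z; field.
  have -> : 2%:R * y = m%:R - 1 by rewrite /y -addn2 natrD; field.
  rewrite powR_inv1 ?ltW// powRB; last by apply/implyP => _; rewrite gt_eqF.
  rewrite powRr1 ?ltW// powR_mulrn ?ltW//; field.
  by rewrite !gt_eqF.
rewrite /incomplete_beta -RintegralZl//; last exact: continuous_integrable_segment.
rewrite /Rintegral; congr fine.
have mH : measurable_fun `]0, phi[ (fun t : R => (2 * sin t ^+ m)%:E).
  apply/measurable_EFinP; apply: measurable_funTS; apply: continuous_measurable_fun => x.
  by apply: cvgM; [exact: cvg_cst|exact: csin].
(* Dropping the end points avoids the possible singularities at s = 0 and s = 1. *)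
rewrite integral_itv_bndoo; last by apply/measurable_EFinP; exact: measurable_funTS.
rewrite [RHS]integral_itv_bndoo//.
rewrite -/(F phi) -[X in `]X, F phi[%classic]F0.
rewrite (@ge0_integration_by_substitution_oo _ F G)//.
- by apply: eq_integral => t /set_mem/=; rewrite in_itv/= => /GF <-.
- move=> s t; rewrite !in_itv/= => /andP[s0 s1] /andP[t0 t1] st.
  have [ss ts] : 0 <= sin s /\ 0 <= sin t by split; apply: sin_ge0_pi; lra.
  by rewrite /F ltr_pXn2r ?nnegrE// ltr_sin ?in_itv/=; lra.
- rewrite dFE => x; apply: cvgM; last exact: continuous_cos.
  by apply: cvgM; [exact: cvg_cst|exact: continuous_sin].
- by move=> x /trig[s0 c0]; rewrite dFE !mulr_ge0// ltW.
- move=> s; rewrite F0 in_itv/= => /andP[s0 sF].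
  have s1 : s < 1.
    by apply: lt_le_trans sF _; rewrite /F sin2cos2 lerBlDr lerDl sqr_ge0.
  apply: cvgM; first exact: continuous_powR_gt0.
  apply: (@continuous_comp _ _ _ (fun s : R => 1 - s) (@powR R ^~ z)).
    by apply: cvgB; [exact: cvg_cst|exact: cvg_id].
  by apply: continuous_powR_gt0; rewrite subr_gt0.
Qed.

(** The reflection t -> pi - t swaps the two halves of [0, pi] and preserves the sine. *)
Lemma Rintegral_sin_pi m :
  \int[mu]_(t in `[0, pi]) (sin t ^+ m) = 2 * \int[mu]_(t in `[0, pi / 2]) (sin t ^+ m).
Proof.
have pi0 := @pi_gt0 R.
have csin := @continuous_sinX R m.
have int a b : mu.-integrable `[a, b] (EFin \o (fun t : R => sin t ^+ m)).
  exact: continuous_integrable_segment.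
have E := @Rintegral_itvB _ (fun t : R => sin t ^+ m) (BLeft 0) (BRight pi) (pi / 2).
have {}E := E (int _ _).
rewrite mulr_natl mulr2n; apply/eqP; rewrite -subr_eq E ?bnd_simp; [|lra..].
rewrite Rintegral_itv_obnd_cbnd; last first.
  by apply: integrableS (int (pi / 2) pi) => //; exact: subset_itv_oc_cc.
rewrite /Rintegral; apply/eqP; congr fine.
have dF (x : R) : is_derive x 1 (fun t : R => pi - t) (-1).
  have := is_deriveB (is_derive_cst (pi : R) x 1) (is_derive_id x (1 : R)).
  by rewrite sub0r.
have dFE : derive1 (fun t : R => pi - t) = cst (-1).
  by apply/funext => t; rewrite derive1E; apply: derive_val.
have cF : continuous (fun t : R => pi - t).
  by move=> x; apply: cvgB; [exact: cvg_cst|exact: cvg_id].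
have := @integration_by_substitution_decreasing R
  (fun t => pi - t) (fun t => sin t ^+ m) 0 (pi / 2).
rewrite subr0 (_ : pi - pi / 2 = pi / 2); last by field.
move=> -> //.
- apply: eq_integral => t _; congr EFin.
  change (sin (pi - t) ^+ m * - derive1 (fun t : R => pi - t) t = sin t ^+ m).
  by rewrite dFE/= opprK mulr1 sinB sinpi cospi mul0r sub0r mulN1r opprK.
- by lra.
- by move=> x y _ _ xy; lra.
- by rewrite dFE => ? _; exact: cvg_cst.
- by rewrite dFE; exact: is_cvg_cst.
- by rewrite dFE; exact: is_cvg_cst.
- split.
  + by move=> x _; case: (dF x).
  + exact/cvg_at_right_filter/cF.
  + exact/cvg_at_left_filter/cF.
- exact: continuous_subspaceT.
Qed.

End BetaSine.

(** * Geometry of touching spheres *)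

Section KissingGeometry.
Context {R : realType}.
Notation mu := (@lebesgue_measure R).

(** The reflection exchanging c and the first basis vector e, or the identity if c = e. It turns
    projection to the tangent space at c into dropping the first coordinate. *)
Lemma householder n (c : 'rV[R]_n.+1) : dot c c = 1 ->
  exists f : 'rV[R]_n.+1 -> 'rV[R]_n.+1,
    (forall x y, dot (f x) (f y) = dot x y) /\
    (forall x, f x ord0 ord0 = dot c x).
Proof.
move=> c1; pose e : 'rV[R]_n.+1 := delta_mx ord0 ord0.
have dote x : dot e x = x ord0 ord0.
  rewrite /dot (bigD1 ord0)//= mxE !eqxx mul1r big1 ?addr0// => i /negbTE i0.
  by rewrite mxE i0 andbF mul0r.
have e1 : dot e e = 1 by rewrite dote mxE !eqxx.
have [->|ce] := eqVneq c e; first by exists id; split.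
have [v vE] : exists v, v = c - e by exists (c - e).
pose w := dot v v.
have w0 : w != 0 by apply: contra ce => /eqP/dot_eq0/eqP; rewrite vE subr_eq0.
exists (fun x => x - (2 * dot v x / w) *: v); split=> x.
  by move=> y; rewrite !(dotBl, dotBr, dotZl, dotZr) -/w [dot x v]dotC; field.

rewrite -[LHS]dote dotBr dotZr [dot e v]dotC.
(* As c and e are unit vectors, |c - e|^2 = -2 <c - e, e>, so the subtracted multiple of v turns <e,
   x> into <e, x> + <v, x> = <c, x>. *)
have wE : w = - 2 * dot v e.
  by rewrite /w vE !(dotBl, dotBr) c1 e1 [dot e c]dotC; ring.
rewrite wE in w0 *.
have -> : dot c x = dot e x + dot v x by rewrite vE dotBl; ring.
by field; move: w0; rewrite mulf_eq0 negb_or => /andP[_].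
Qed.

Lemma acos_lt (a r : R) : -1 <= a <= 1 -> 0 <= r <= pi -> cos r < a -> acos a < r.
Proof.
move=> a1 rpi ra; rewrite -ltr_cos ?in_itv//= ?acos_ge0 ?acos_lepi//.
by rewrite acosK.
Qed.

Lemma cos_geodist n (x y : 'rV[R]_n.+1) : dot x x = 1 -> dot y y = 1 ->
  cos (geodist x y) = dot x y.
Proof. by move=> x1 y1; rewrite acosK// in_itv/= dot_unit_itv. Qed.

(** If the centres were closer than 2 r, the spherical midpoint, x + y divided by its length, would
    lie in both interiors. *)
Lemma disjoint_ginterior_dot_le n (x y : 'rV[R]_n.+1) (r : R) :
  0 <= r <= pi / 2 -> dot x x = 1 -> dot y y = 1 ->
  ginterior x r `&` ginterior y r = set0 -> dot x y <= 2 * cos r ^+ 2 - 1.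
Proof.
move=> /andP[r0 rpi] x1 y1 disj; rewrite leNgt; apply/negP => lt.
have cr0 : 0 <= cos r by apply: cos_ge0_pihalf; lra.
pose q := 2 + 2 * dot x y; pose s := Num.sqrt q.
have q0 : 0 < q by rewrite /q; have := sqr_ge0 (cos r); lra.
have s0 : 0 < s by rewrite sqrtr_gt0.
have ss : s * s = q by rewrite -expr2 sqr_sqrtr// ltW.
pose m := s^-1 *: (x + y).
have mm : dot m m = 1.
  rewrite dotZl dotZr !(dotDl, dotDr) x1 y1 [dot y x]dotC.
  have -> : 1 + dot x y + (dot x y + 1) = s * s by rewrite ss /q; ring.
  by rewrite mulKf ?mulVf ?gt_eqF.
have mid z : dot z z = 1 -> dot z (x + y) = 1 + dot x y -> ginterior z r m.
  move=> z1 zxy; split => //; apply: acos_lt; first exact: dot_unit_itv.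
    by have := @pi_gt0 R; lra.
  rewrite dotZr zxy mulrC ltr_pdivlMr//.
  have cs0 : 0 <= cos r * s by rewrite mulr_ge0// ltW.
  have q2 : 0 <= 1 + dot x y by move: q0; rewrite /q; lra.
  rewrite -(@ltr_pXn2r _ 2)// exprMn [s ^+ 2]expr2 ss /q.
  have : 0 < (1 + dot x y) * (1 + dot x y - 2 * cos r ^+ 2).
    by apply: mulr_gt0; move: q0; rewrite /q; lra.
  by rewrite [(1 + _) ^+ 2]expr2; lra.
have : (ginterior x r `&` ginterior y r) m.
  split; apply: (mid) => //; rewrite dotDr ?x1 ?y1//.
  by rewrite addrC dotC.
by rewrite disj.
Qed.

(** For a common point z, the squared length of x + y - 2 cos r z is 2 + 2 <x, y> - 4 cos^2 r. *)
Lemma meeting_gsphere_dot_ge n (x y : 'rV[R]_n.+1) (r : R) :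
  dot x x = 1 -> dot y y = 1 ->
  gsphere x r `&` gsphere y r !=set0 -> 2 * cos r ^+ 2 - 1 <= dot x y.
Proof.
move=> x1 y1 [z [[z1 xz] [_ yz]]].
have xzE : dot x z = cos r by rewrite -xz cos_geodist.
have yzE : dot y z = cos r by rewrite -yz cos_geodist.
have := dot_ge0 (x + y - (2 * cos r) *: z).
rewrite !(dotDl, dotDr, dotNl, dotNr, dotZl, dotZr) [dot y x]dotC.
by rewrite [dot z x]dotC [dot z y]dotC xzE yzE x1 y1 z1 expr2; lra.
Qed.

(** The triple angle formula gives 4 c^3 - 3 c = -1, that is (c + 1) (2 c - 1)^2 = 0, and c > 0. *)
Lemma cos_pi3 : cos (pi / 3) = 1 / 2 :> R.
Proof.
have pi0 := @pi_gt0 R.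
have c0 : 0 < cos (pi / 3 : R) by apply: cos_gt0_pihalf; lra.
have : cos (pi / 3 + (pi / 3) *+ 2) = -1 :> R.
  by rewrite -cospi; congr cos; rewrite mulr2n; field.
rewrite cosD cos_mulr2n sin_mulr2n; move: (sin2cos2 (pi / 3 : R)).
set c := cos _ in c0 *; set s := sin _ => s2.
have -> : c * (c ^+ 2 *+ 2 - 1) - s * (c * s *+ 2) =
    c * (c ^+ 2 * 2 - 1) - c * 2 * s ^+ 2.
  by ring.
rewrite s2 => E.
have : (c + 1) * (2 * c - 1) ^+ 2 = 0 by move: E; rewrite !exprS expr0; lra.
move/eqP; rewrite mulf_eq0 expf_eq0/= => /orP[/eqP|/eqP]; lra.
Qed.

(** The integrand dominates cos t sin^m t, whose integral is sin^(m+1) phi / (m + 1). *)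
Lemma Rintegral_sin_gt0 m (phi : R) : 0 < phi <= pi / 2 ->
  0 < \int[mu]_(t in `[0, phi]) (sin t ^+ m).
Proof.
move=> /andP[phi0 phipi]; have pi0 := @pi_gt0 R.
have dF (t : R) : is_derive t 1 (fun t : R => sin t ^+ m.+1)
    (m.+1%:R * (cos t ^+ 1 * sin t ^+ m)).
  rewrite (_ : (fun t : R => _) = (@sin R : R -> R) ^+ m.+1); last first.
    by apply/funext => ?; rewrite !fctE.
  by apply: is_derive_eq; rewrite /GRing.scale/= expr1; ring.
have cont : continuous (fun t : R => m.+1%:R * (cos t ^+ 1 * sin t ^+ m)).
  by move=> t; apply: cvgM; [exact: cvg_cst|exact: continuous_trig_monomial].
have := Rintegral_derive (ltW phi0) cont dF.
rewrite sin0 expr0n subr0 RintegralZl//; last first.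
  exact/continuous_integrable_segment/continuous_trig_monomial.
move=> E; have : 0 < sin phi ^+ m.+1 by rewrite exprn_gt0// sin_gt0_pi; lra.
rewrite -E pmulr_rgt0// => /lt_le_trans; apply.
apply: le_Rintegral => //.
- exact/continuous_integrable_segment/continuous_trig_monomial.
- exact/continuous_integrable_segment/continuous_sinX.
- move=> t; rewrite /= in_itv/= => /andP[t0 tphi].
  by rewrite expr1 ler_piMl ?cos_le1// exprn_ge0// sin_ge0_pi; lra.
Qed.

(* The projections of the centres to the tangent space at [c] have pairwise
   angles at least [2 phi], by the spherical law of cosines. *)
Lemma kissing_configuration_bound m (r phi : R) (c : 'rV[R]_m.+3)
    (X : {fset 'rV[R]_m.+3}) :
  0 < r <= pi / 3 -> 0 <= phi <= pi / 2 -> sin phi = sec r / 2 ->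
  kissing_configuration r c X ->
  #|` X|%:R * \int[mu]_(t in `[0, phi]) (sin t ^+ m) <=
  \int[mu]_(t in `[0, pi]) (sin t ^+ m).
Proof.
move=> /andP[r0 rpi] phipi sphi [c1 touchX trivX]; have pi0 := @pi_gt0 R.
have r_itv : 0 <= r <= pi / 2 by lra.
have cr0 : 0 < cos r by apply: cos_gt0_pihalf; lra.
have cr1 : cos r < 1 by rewrite -(@cos0 R) ltr_cos ?in_itv/=; lra.
(* This is cos (2 r), strictly between -1 and 1 as 0 < r <= pi / 3; hence the projections below do
   not vanish. *)
pose k := 2 * cos r ^+ 2 - 1.
have k1 : k < 1 by rewrite /k expr2; nra.
have kN1 : -1 < k by rewrite /k expr2; nra.
have kk0 : 0 < 1 - k ^+ 2 by rewrite expr2; nra.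
(* Disjoint interiors give one inequality, a common point of the spheres the other. *)
have dotcX x : x \in X -> dot c x = k.
  move=> /touchX[x1 [meet disj]]; apply/eqP; rewrite eq_le.
  by rewrite disjoint_ginterior_dot_le//= meeting_gsphere_dot_ge.
have dotXX x y : x \in X -> y \in X -> x != y -> dot x y <= k.
  move=> xX yX xy; have [x1 _] := touchX _ xX; have [y1 _] := touchX _ yX.
  apply: disjoint_ginterior_dot_le => //; apply/eqP; apply/negPn/negP => /set0P ne.
  by move/eqP: xy; apply; apply: trivX.
have [f [fdot f0]] := householder c1.
pose X_ (i : 'I_#|` X|) := nth 0 X i.
have X_X i : X_ i \in X by apply: mem_nth.
pose s := Num.sqrt (1 - k ^+ 2).
have s0 : 0 < s by rewrite sqrtr_gt0.
have ss : s * s = 1 - k ^+ 2 by rewrite -expr2 sqr_sqrtr// ltW.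
(* After the reflection every centre has first coordinate k, so its tail has length s and [u i] is
   its unit direction seen from c. *)
pose u i := s^-1 *: vtail (f (X_ i)).
have dotu i j : dot (u i) (u j) = (dot (X_ i) (X_ j) - k ^+ 2) / (1 - k ^+ 2).
  rewrite dotZl dotZr -fdot [dot (f _) _]dot_recl !f0 !dotcX// -ss.
  by field; rewrite gt_eqF.
apply: (cap_packing (u := u)) => // [i|i j ij].
  have [x1 _] := touchX _ (X_X i).
  by rewrite dotu x1 divff// gt_eqF.
have XX : dot (X_ i) (X_ j) <= k.
  apply: dotXX => //; rewrite /X_ nth_uniq ?fset_uniq//.
rewrite dotu cos2sin2 sphi /sec ler_pdivrMr//.
(* Here (k - k^2) / (1 - k^2) = k / (1 + k) = 1 - sec^2 r / 2, which is 2 cos^2 phi - 1 since sin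
   phi = sec r / 2. *)
rewrite (le_trans (_ : _ <= k - k ^+ 2)) ?lerB//.
rewrite le_eqVlt; apply/orP; left; apply/eqP.
by rewrite /k; field; rewrite gt_eqF.
Qed.

End KissingGeometry.

(** * From the packing bound to beta functions, with radius 0 apart *)

Theorem theorem3p1 (R : realType) (n : nat) (r : R) :
  (2 <= n)%N -> 0 <= r <= pi / 3 ->
  (kissing_number n r <=
    (2 * beta ((n%:R - 1) / 2) (1 / 2)
     / incomplete_beta (sec r ^+ 2 / 4) ((n%:R - 1) / 2) (1 / 2))%:E)%E.
Proof.
case: n => [|[|m]]// _ /andP[r0 rpi]; have pi0 := @pi_gt0 R.
(* This makes sec r / 2 at most 1, so that its arcsine [phi] is meaningful. *)
have cr : 1 / 2 <= cos r.
  rewrite -cos_pi3; move: rpi; rewrite le_eqVlt => /predU1P[->//|rpi].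
  by apply/ltW; rewrite ltr_cos ?in_itv/=; lra.
have cr0 : 0 < cos r by lra.
have sec_itv : 0 < sec r / 2 <= 1.
  rewrite divr_gt0 ?invr_gt0//= /sec ler_pdivrMr// mul1r.
  by rewrite -[leRHS]invrK lef_pV2 ?posrE//; lra.
pose phi := asin (sec r / 2).
have sphi : sin phi = sec r / 2 by rewrite asinK// in_itv/=; lra.
have phipi : phi <= pi / 2 by apply: asin_lepi2; lra.
have phi0 : 0 < phi.
  rewrite ltNge; apply/negP => phi0.
  have : sin (- phi) >= 0 :> R.
    apply: sin_ge0_pi; have := @asin_geNpi2 R (sec r / 2); rewrite -/phi.
    by move=> /(_ _); lra.
  by rewrite sinN sphi; lra.
have phi_itv : 0 < phi <= pi / 2 by rewrite phi0.
(* The complete beta function is the case of angle pi / 2, where the sine is 1. *)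
have -> : beta ((m.+2%:R - 1) / 2) (1 / 2) =
    \int[@lebesgue_measure R]_(t in `[0, pi]) (sin t ^+ m) :> R.
  rewrite Rintegral_sin_pi -incomplete_beta_sin ?sin_pihalf ?expr1n//.
  by apply/andP; split; lra.
have -> : incomplete_beta (sec r ^+ 2 / 4) ((m.+2%:R - 1) / 2) (1 / 2) =
    2 * \int[@lebesgue_measure R]_(t in `[0, phi]) (sin t ^+ m) :> R.
  by rewrite -incomplete_beta_sin// sphi; congr (incomplete_beta _ _ _); field.
apply: ge_ereal_sup => _ [c [X [kX ->]]].
rewrite lee_fin ler_pdivlMr ?mulr_gt0 ?Rintegral_sin_gt0// mulrCA ler_pM2l//.
(* For r = 0 the touching centres coincide with c and have no direction from it, so they are counted
   directly. *)
have [r_eq0|r_neq0] := eqVneq r 0; last first.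
  apply: (kissing_configuration_bound _ _ sphi kX); last by rewrite ltW.
  by rewrite lt_neqAle eq_sym r_neq0 r0.
case: kX => c1 touchX _.
(* A sphere of radius 0 is a point, so it touches only itself. *)
have card_le1 : (#|` X| <= 1)%N.
  apply: (@leq_trans #|` [fset c]%fset|); last by rewrite cardfs1.
  apply: fsubset_leq_card; apply/fsubsetP => x /touchX[x1 [meet _]].
  have := meeting_gsphere_dot_ge c1 x1 meet; rewrite r_eq0 cos0 expr1n => h.
  have : dot (x - c) (x - c) = 0.
    apply/eqP; rewrite eq_le dot_ge0 andbT !(dotBl, dotBr) [dot x c]dotC.
    by rewrite c1 x1; lra.
  by move=> /dot_eq0/eqP; rewrite subr_eq0 inE.
apply: (@le_trans _ _ (\int[@lebesgue_measure R]_(t in `[0, phi]) (sin t ^+ m))).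
  by rewrite ler_piMl ?lern1// ltW// Rintegral_sin_gt0.
apply: Rintegral_itv_le.
- exact: continuous_sinX.
- by apply/andP; split; lra.
- by move=> t /andP[t0 tpi]; rewrite exprn_ge0// sin_ge0_pi//; lra.
Qed.
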